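(* Let $a>b>0$ and $x_0,y_0$ be real numbers, let $\Gamma:\ (x-x_0)^2+(y-y_0)^2=1$, and let $\mathcal{C}(t):\ \frac{x^2}{a-t}+\frac{y^2}{b-t}=1$. Then the following are equivalent: (i) for each $t\notin\{a,b\}$ there are quadrangles inscribed in the circle $\Gamma$ and circumscribed about the conic $\mathcal{C}(t)$ (i.e. $\Gamma$ and $\mathcal{C}(t)$ are a $4$-Poncelet pair); (ii) the focal points $(\pm\sqrt{a-b},0)$ of the family $\mathcal{C}(t)$ either both belong to $\Gamma$ or are symmetric to each other with respect to $\Gamma$.
   Context: The parameter $t$ ranges over $\mathbb{C}$; $\mathcal{C}(t)$ is a non-degenerate conic for $t\notin\{a,b\}$. Two points are symmetric with respect to a circle if they are exchanged by the inversion in that circle. For an integer $n\ge 3$, $\Gamma$ and $\mathcal{C}(t)$ are an $n$-Poncelet pair (also: $\mathcal{C}(t)$ is $n$-Poncelet inscribed in $\Gamma$) if there is a closed polygonal line with $n$ sides inscribed in $\Gamma$ (vertices on $\Gamma$) and circumscribed about $\mathcal{C}(t)$ (lines containing the sides are tangent to $\mathcal{C}(t)$). As usual for Poncelet's theorem, this is understood in the complexified projective plane: consecutive vertices are the two intersections of a side with $\Gamma$, and consecutive sides are the two tangents from a vertex to $\mathcal{C}(t)$, both counted with multiplicity; the trivial polygon sitting at a point of tangency of the two conics is not counted. For $t\notin\{a,b\}$ this is equivalent to Cayley's condition $p_n(t)=0$, where, with $$D_t(\lambda)=(a-t)(b-t)\det(\mathcal{C}(t)+\lambda\Gamma),\quad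 \Gamma=\begin{pmatrix}1&0&-x_0\\0&1&-y_0\\-x_0&-y_0&x_0^2+y_0^2-1\end{pmatrix},\quad \mathcal{C}(t)=\mathrm{diag}\left(\tfrac1{a-t},\tfrac1{b-t},-1\right),$$ and $\sqrt{D_t(\lambda)}=\sum_{k\ge0}C_k(t)\lambda^k$ the Taylor series at $\lambda=0$, one puts $p_{2m+1}(t)=\det(C_{i+j}(t))_{1\le i,j\le m}$ and $p_{2m+2}(t)=\det(C_{i+j+1}(t))_{1\le i,j\le m}$ for $m\ge1$. *)

(* Defs.v *)
From HB Require Import structures.
From mathcomp Require Import all_boot all_order all_algebra.
From mathcomp Require Import reals.
From mathcomp Require Import complex ring.

Set Implicit Arguments.
Unset Strict Implicit.
Unset Printing Implicit Defensive.

Import Order.TTheory GRing.Theory Num.Theory.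
Local Open Scope ring_scope.

(* Points and lines of the projective plane over K are both given by nonzero
   row vectors (homogeneous coordinates); [(p == q)%MS] is equality of the
   represented points (or lines).  A conic is given by a symmetric matrix, which
   is assumed to be invertible (char K != 2) in all the comments below. *)
Section ProjectiveConics.
Variable K : fieldType.
Implicit Types (p q l m : 'rV[K]_3) (M : 'M[K]_3).

Definition incident p l : Prop := p *m l^T = 0.

Definition on_conic M p : Prop := p *m M *m p^T = 0.

(* The tangent line to M at p is the polar line of p. *)
Definition tangent_at M p l : Prop := on_conic M p /\ (l == p *m M)%MS.

Definition tangent M l : Prop := exists2 p, p != 0 & tangent_at M p l.

(* p and q are the two intersections of l with M, counted with multiplicity:
   p = q exactly when l is tangent to M at p. *)
Definition chord M l p q : Prop :=
  [/\ incident p l, incident q l, on_conic M p, on_conic M q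
    & (p == q)%MS -> tangent_at M p l].

(* l and m are the two tangents to M from p, counted with multiplicity: they
   coincide exactly when p lies on M, and then they are the tangent at p. *)
Definition tangent_pair M p l m : Prop :=
  [/\ incident p l, incident p m, tangent M l, tangent M m
    & (l == m)%MS -> tangent_at M p l].

(* P i are the vertices, L i is the side joining P i to P (i + 1), with indices
   modulo n; the sides meeting at P (i + 1) are L i and L (i + 1). *)
Definition poncelet_polygon n (G C : 'M[K]_3) (P L : 'I_n -> 'rV[K]_3) : Prop :=
  forall i : 'I_n,
    [/\ P i != 0, L i != 0, chord G (L i) (P i) (P (ordS i))
      & tangent_pair C (P (ordS i)) (L i) (L (ordS i))].

(* The constant polygon at a point of tangency p of G and C, all of whose sides
   are the common tangent l there. *)
Definition trivial_polygon n (G C : 'M[K]_3) (P L : 'I_n -> 'rV[K]_3) : Prop :=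
  exists p l, [/\ p != 0, tangent_at G p l, tangent_at C p l
    & forall i, (P i == p)%MS /\ (L i == l)%MS].

Definition poncelet_pair n (G C : 'M[K]_3) : Prop :=
  exists P L : 'I_n -> 'rV[K]_3,
    poncelet_polygon G C P L /\ ~ trivial_polygon G C P L.

Definition row3 (x y z : K) : 'rV[K]_3 := \row_(j < 3) [:: x; y; z]`_j.

Definition circle_mx (x0 y0 : K) : 'M[K]_3 :=
  \matrix_(i < 3, j < 3)
    (nth [::]
      [:: [:: 1; 0; - x0];
          [:: 0; 1; - y0];
          [:: - x0; - y0; x0 ^+ 2 + y0 ^+ 2 - 1]] i)`_j.

Definition confocal_mx (a b t : K) : 'M[K]_3 :=
  diag_mx (row3 (a - t)^-1 (b - t)^-1 (-1)).

Lemma on_circle_mx (x0 y0 x y : K) :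
  on_conic (circle_mx x0 y0) (row3 x y 1) <->
  (x - x0) ^+ 2 + (y - y0) ^+ 2 = 1.
Proof.
have E : row3 x y 1 *m circle_mx x0 y0 *m (row3 x y 1)^T =
         ((x - x0) ^+ 2 + (y - y0) ^+ 2 - 1)%:M.
  apply/matrixP=> i j; rewrite !ord1 !mxE !big_ord_recl big_ord0 /=.
  by rewrite !mxE !big_ord_recl !big_ord0 /= !mxE /=; ring.
rewrite /on_conic E; split=> [/matrixP /(_ 0 0)|->]; last by rewrite subrr raddf0.
by rewrite !mxE /= mulr1n => /eqP; rewrite subr_eq0 => /eqP.
Qed.

Lemma on_confocal_mx (a b t x y : K) :
  on_conic (confocal_mx a b t) (row3 x y 1) <->
  x ^+ 2 / (a - t) + y ^+ 2 / (b - t) = 1.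
Proof.
have E : row3 x y 1 *m confocal_mx a b t *m (row3 x y 1)^T =
         (x ^+ 2 / (a - t) + y ^+ 2 / (b - t) - 1)%:M.
  apply/matrixP=> i j; rewrite !ord1 mul_mx_diag !mxE !big_ord_recl big_ord0 /=.
  by rewrite !mxE /=; ring.
rewrite /on_conic E; split=> [/matrixP /(_ 0 0)|->]; last by rewrite subrr raddf0.
by rewrite !mxE /= mulr1n => /eqP; rewrite subr_eq0 => /eqP.
Qed.

End ProjectiveConics.

Section RealCircle.
Variable R : realType.
Implicit Types (o p q : R * R) (r : R).

Definition on_circle o r p : Prop :=
  (p.1 - o.1) ^+ 2 + (p.2 - o.2) ^+ 2 = r ^+ 2.

(* Only meaningful for p <> o, since the center is sent to infinity. *)
Definition inversion o r p : R * R :=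
  let k := r ^+ 2 / ((p.1 - o.1) ^+ 2 + (p.2 - o.2) ^+ 2) in
  (o.1 + k * (p.1 - o.1), o.2 + k * (p.2 - o.2)).

Definition circle_symmetric o r p q : Prop :=
  [/\ p <> o, q <> o, inversion o r p = q & inversion o r q = p].

End RealCircle.

(* Main.v *)
Require Import Defs.
From mathcomp Require Import all_boot all_order all_algebra.
From mathcomp Require Import reals.
From mathcomp Require Import complex ring.

Import Order.TTheory GRing.Theory Num.Theory.
Local Open Scope ring_scope.
Local Open Scope complex_scope.

(* Necessity. Put T = tr(G C^-1) - 2 G C^-1.  If p and q are the endpoints of a
   chord of G tangent to C, then p T and q are conjugate with respect to G.
   Hence, in a quadrangle P0 P1 P2 P3 with P0 <> P2, both P1 T and P3 T are the
   pole of the line P0 P2; if P0 = P2, multiplicities force P1 and P3 to lie on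
   C, and P1 T, P3 T both represent P0.  If T were invertible, this would give
   P1 = P3 and P0 = P2, and then the polygon would be trivial.  So det T = 0,
   which for the confocal family is affine in t; its two coefficients vanish
   exactly when [x0 = 0, a - b + y0^2 = 1] or [y0 = 0, x0^2 = 1 + (a - b)], and
   these are the two positions of the foci.

   Sufficiency. If the foci lie on the circle, then together with the two
   circular points they are the vertices of a quadrangle whose sides are
   isotropic lines, tangent to all conics of the family.  If the foci are
   symmetric, two tangents to C(t) at common points of C(t) and the circle that
   are exchanged by the reflection in the x-axis meet on the circle, which gives
   a quadrangle traversed back and forth. *)

(** * Incidence, chords and tangents of conics over a general field *)

Section ProjectivePoncelet.
Variable K : fieldType.
Implicit Types (p q l m : 'rV[K]_3) (M G C D T : 'M[K]_3).

Lemma incident_sym p l : incident p l -> incident l p.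
Proof. by rewrite /incident => h; rewrite -[LHS]trmxK trmx_mul trmxK h trmx0. Qed.

Lemma sub_incident p q l : (p <= q)%MS -> incident q l -> incident p l.
Proof.
case/sub_rVP=> k ->; rewrite /incident => h.
by rewrite -scalemxAl h scaler0.
Qed.

Lemma eqmx_rV p q : p != 0 -> (p <= q)%MS -> (p == q)%MS.
Proof.
move=> p0 pq; rewrite pq /=; have/sub_rVP[k e] := pq.
apply/sub_rVP; exists k^-1; rewrite e scalerA mulVf ?scale1r //.
by apply: contraNneq p0 => k0; rewrite e k0 scale0r.
Qed.

(** Points on both lines lie in the kernel of a matrix of rank 2 with three rows; this kernel has
    dimension at most 1, so the nonzero [p] spans it. *)
Lemma incident_uniq p q l m :
  l != 0 -> m != 0 -> ~~ (l == m)%MS -> p != 0 ->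
  incident p l -> incident p m -> incident q l -> incident q m -> (q <= p)%MS.
Proof.
move=> l0 m0 lm p0 pl pm ql qm.
have rk : (2 <= \rank (col_mx l m)^T)%N.
  have : (l < l + m)%MS.
    rewrite ltmxE addsmxSl addsmx_sub submx_refl /=.
    by apply: contra lm => /(eqmx_rV _ _ m0) /andP[h1 h2]; rewrite h1 h2.
  by rewrite ltmxErank mxrank_tr -addsmxE rank_rV l0 => /andP[].
have inker r : incident r l -> incident r m -> (r <= kermx (col_mx l m)^T)%MS.
  move=> rl rm; apply/sub_kermxP; rewrite tr_col_mx mul_mx_row.
  by rewrite (rl : _ = 0) (rm : _ = 0) row_mx0.
have pk := inker p pl pm; apply: submx_trans (inker q ql qm) _.
rewrite -(geq_leqif (mxrank_leqif_sup pk)) rank_rV p0 mxrank_ker.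
exact: (leq_sub2l 3 rk).
Qed.

(** For distinct points this is the line joining them; for proportional rows it is zero. *)
Definition cross p q : 'rV[K]_3 :=
  row3 (p 0 1 * q 0 2%:R - p 0 2%:R * q 0 1)
       (p 0 2%:R * q 0 0 - p 0 0 * q 0 2%:R)
       (p 0 0 * q 0 1 - p 0 1 * q 0 0).

Lemma row3E p : p = row3 (p 0 0) (p 0 1) (p 0 2%:R).
Proof.
apply/rowP => -[[|[|[|//]]] hj]; rewrite !mxE /=; congr (p 0 _); exact: val_inj.
Qed.

Lemma sum3E (F : 'I_3 -> K) : \sum_i F i = F 0 + F 1 + F 2%:R.
Proof.
rewrite !big_ord_recl big_ord0 addr0 addrA; congr (F _ + F _ + F _); exact: val_inj.
Qed.

Lemma det3E M : \det M =
  M 0 0 * (M 1 1 * M 2%:R 2%:R - M 1 2%:R * M 2%:R 1)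
  - M 0 1 * (M 1 0 * M 2%:R 2%:R - M 1 2%:R * M 2%:R 0)
  + M 0 2%:R * (M 1 0 * M 2%:R 1 - M 1 1 * M 2%:R 0).
Proof.
rewrite (expand_det_row _ 0) sum3E /cofactor !(expand_det_row _ ord0).
rewrite !big_ord_recl !big_ord0 /cofactor !det_mx11 !mxE /=.
have e1 : lift 0 0 = 1 :> 'I_3 by exact: val_inj.
have e2 : lift 1 0 = 0 :> 'I_3 by exact: val_inj.
have e3 : lift 2%:R 0 = 0 :> 'I_3 by exact: val_inj.
have f1 : lift 0 (lift 0 0) = 2%:R :> 'I_3 by exact: val_inj.
have f2 : lift 1 (lift 0 0) = 2%:R :> 'I_3 by exact: val_inj.
have f3 : lift 2%:R (lift 0 0) = 1 :> 'I_3 by exact: val_inj.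
have g1 : lift 0 (lift (lift 0 0) 0) = 1 :> 'I_3 by exact: val_inj.
have g2 : lift 1 (lift (lift 0 0) 0) = 0 :> 'I_3 by exact: val_inj.
have g3 : lift 2%:R (lift (lift 0 0) 0) = 0 :> 'I_3 by exact: val_inj.
by rewrite !ord1 ?(f1, f2, f3, g1, g2, g3, e1, e2, e3) /bump /=; ring.
Qed.

Lemma bilinear3E M p q : (p *m M *m q^T) 0 0 =
  (p 0 0 * M 0 0 + p 0 1 * M 1 0 + p 0 2%:R * M 2%:R 0) * q 0 0
  + (p 0 0 * M 0 1 + p 0 1 * M 1 1 + p 0 2%:R * M 2%:R 1) * q 0 1
  + (p 0 0 * M 0 2%:R + p 0 1 * M 1 2%:R + p 0 2%:R * M 2%:R 2%:R) * q 0 2%:R.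
Proof. by rewrite mxE sum3E ![(_ *m _) _ _]mxE !sum3E !mxE. Qed.

(* The linear part at Y = G, in the direction Z, of the identity
   (p x q) adj(Y) (p x q)^T = (p Y p^T) (q Y q^T) - (p Y q^T)^2:
   Z is chosen so that the derivative of adj is 2 (det G) D. *)
Lemma cross_dual_conic G D p q : G^T = G -> D^T = D ->
  let Z := (\tr (G *m D)) *: G - (G *m D *m G) *+ 2 in
  (\det G *: (cross p q *m D *m (cross p q)^T)) *+ 2 =
   (p *m G *m p^T) *m (q *m Z *m q^T) + (p *m Z *m p^T) *m (q *m G *m q^T)
    - ((p *m G *m q^T) *m (p *m Z *m q^T)) *+ 2.
Proof.
move=> Gs Ds Z.
have gs i j : G i j = G j i by rewrite -{1}Gs mxE.
have ds i j : D i j = D j i by rewrite -{1}Ds mxE.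
have mul11 (X Y : 'M[K]_1) : (X *m Y) 0 0 = X 0 0 * Y 0 0 by rewrite mxE big_ord1.
have add11 (X Y : 'M[K]_1) : (X + Y) 0 0 = X 0 0 + Y 0 0 by rewrite mxE.
have opp11 (X : 'M[K]_1) : (- X) 0 0 = - X 0 0 by rewrite mxE.
have scale11 k (X : 'M[K]_1) : (k *: X) 0 0 = k * X 0 0 by rewrite mxE.
apply/matrixP=> i j; rewrite !ord1 !mulr2n.
rewrite !(add11, opp11, scale11, mul11) !bilinear3E.
rewrite det3E /Z /mxtrace sum3E !(mxE, sum3E) /=.
(* Moving every entry to the upper triangle leaves a polynomial identity in independent
   variables. *)
rewrite (gs 1 0) (gs 2%:R 0) (gs 2%:R 1) (ds 1 0) (ds 2%:R 0) (ds 2%:R 1).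
ring.
Qed.

Lemma eqmxb_sym p q : (p == q)%MS -> (q == p)%MS.
Proof. by rewrite andbC. Qed.

Lemma eqmxb_trans p q m : (p == q)%MS -> (q == m)%MS -> (p == m)%MS.
Proof. by move=> /eqmxP h1 /eqmxP h2; apply/eqmxP; exact: eqmx_trans h1 h2. Qed.

Lemma eqmxbMr p q M : (p == q)%MS -> (p *m M == q *m M)%MS.
Proof. by move=> /eqmxP h; apply/eqmxP; exact: eqmxMr. Qed.

Lemma on_conic_sub M p q : (q <= p)%MS -> on_conic M p -> on_conic M q.
Proof.
case/sub_rVP=> k ->; rewrite /on_conic => h.
by rewrite linearZ /= -!scalemxAl -scalemxAr h !scaler0.
Qed.

Lemma tangent_at_eq M p q l m :
  (p == q)%MS -> (l == m)%MS -> tangent_at M p l -> tangent_at M q m.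
Proof.
move=> pq lm [h1 h2]; split; first by case/andP: pq => _ /on_conic_sub; exact.
apply: eqmxb_trans (eqmxbMr _ _ M pq); apply: eqmxb_trans h2; exact: eqmxb_sym.
Qed.

Lemma chord_sym M l p q : chord M l p q -> chord M l q p.
Proof.
case=> h1 h2 h3 h4 h5; split=> // /eqmxb_sym qp.
by apply: tangent_at_eq qp _ (h5 qp); rewrite submx_refl.
Qed.

(** Distinct endpoints determine the line through them; for coinciding endpoints the multiplicity
    clause of [chord] makes both lines the tangent there. *)
Lemma chord_uniq M l m p q p' q' :
  p != 0 -> q != 0 -> p' != 0 -> q' != 0 -> l != 0 -> m != 0 ->
  chord M l p q -> chord M m p' q' -> (p == p')%MS -> (q == q')%MS -> (l == m)%MS.
Proof.
move=> p0 q0 p'0 q'0 l0 m0 [h1 h2 h3 h4 h5] [g1 g2 g3 g4 g5] pp qq.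
have [pq|npq] := boolP (p == q)%MS.
  have [_ e1] := h5 pq; have p'q' : (p' == q')%MS.
    by apply: eqmxb_trans qq; apply: eqmxb_trans pq; exact: eqmxb_sym.
  have [_ e2] := g5 p'q'; apply: eqmxb_trans e1 _.
  apply: eqmxb_trans (eqmxb_sym _ _ e2); exact: eqmxbMr.
apply: eqmx_rV l0 _; apply: (incident_uniq m l p q) => //; apply: incident_sym => //.
  by apply: sub_incident g1; case/andP: pp.
by apply: sub_incident g2; case/andP: qq.
Qed.

Lemma mulmx_unit_neq0 p M : M \in unitmx -> p != 0 -> p *m M != 0.
Proof. by move=> uM; apply: contra => /eqP h; rewrite -[p](mulmxK uM) h mul0mx. Qed.

Lemma eqmxb_unit p q M : M \in unitmx -> (p *m M == q *m M)%MS -> (p == q)%MS.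
Proof. by move=> uM /eqmxbMr - /(_ (invmx M)); rewrite !mulmxK. Qed.

Lemma bilinear_sym M p q : M^T = M -> p *m M *m q^T = (q *m M *m p^T)^T.
Proof. by move=> Ms; rewrite !trmx_mul trmxK Ms mulmxA. Qed.

(** Were [p] and [q] conjugate, both polars would pass through these two distinct points and so
    coincide; as [M] is invertible, the points would then be equal. *)
Lemma chord_not_conj M p q : M^T = M -> M \in unitmx -> p != 0 -> q != 0 ->
  on_conic M p -> on_conic M q -> ~~ (p == q)%MS -> p *m M *m q^T != 0.
Proof.
move=> Ms uM p0 q0 hp hq; apply: contra => /eqP h.
apply: contraT => npq; case/negP: (npq).
apply: (eqmxb_unit p q M uM); apply: eqmx_rV (mulmx_unit_neq0 _ _ uM p0) _.
apply: (incident_uniq _ _ p q) => //; first exact: mulmx_unit_neq0.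
by rewrite /incident bilinear_sym // h trmx0.
Qed.

Lemma cross_incidentl p q : incident (cross p q) p.
Proof.
apply/matrixP=> i j; rewrite !ord1 /cross.
by rewrite !(mxE, sum3E) /=; ring.
Qed.

Lemma cross_incidentr p q : incident (cross p q) q.
Proof.
apply/matrixP=> i j; rewrite !ord1 /cross.
by rewrite !(mxE, sum3E) /=; ring.
Qed.

(** A tangent is a multiple of [p *m C] with [p] on the conic, so the dual form at [l] reduces to
    the form of [C] at [p]. *)
Lemma tangent_dual C l : C^T = C -> C \in unitmx -> tangent C l ->
  l *m invmx C *m l^T = 0.
Proof.
move=> Cs uC [p p0 [hp /andP[/sub_rVP[k ->] _]]].
rewrite linearZ /= -!scalemxAl -scalemxAr mulmxK // trmx_mul Cs mulmxA.
by rewrite (hp : _ = 0) !scaler0.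
Qed.

(** In characteristic other than 2, minus the determinant of this matrix is 16 times the coefficient
    of $\lambda^3$ in the square root of $\det(1+\lambda GC^{-1})$, the quantity in Cayley's
    condition for $n=4$. *)
Definition cayley4_mx G C : 'M[K]_3 :=
  (\tr (G *m invmx C))%:M - (G *m invmx C) *+ 2.

(** * Necessary condition for a quadrangle, for a general pair of conics *)

Section Pair.
Variables (G C : 'M[K]_3).
Hypotheses (K2 : 2%:R != 0 :> K) (Gs : G^T = G) (Cs : C^T = C).
Hypotheses (uG : G \in unitmx) (uC : C \in unitmx).
Let T := cayley4_mx G C.

Lemma cayley4_mxE : T *m G = \tr (G *m invmx C) *: G - (G *m invmx C *m G) *+ 2.
Proof. by rewrite /T /cayley4_mx mulmxBl mul_scalar_mx !mulr2n mulmxDl. Qed.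

(** For [p] and [q] distinct, [cross p q] is a multiple of [l], so the left-hand side of
    [cross_dual_conic] vanishes; on the right only the mixed product survives, and its factor
    [p *m G *m q^T] is nonzero. For [p] equal to [q], the trace term of [T *m G] vanishes on [G],
    and the other is the dual form of [C] at the tangent [l]. *)
Lemma tangent_chord_conj l p q : p != 0 -> q != 0 -> l != 0 ->
  chord G l p q -> tangent C l -> incident (p *m T) (q *m G).
Proof.
move=> p0 q0 l0 [pl ql hp hq pq] /(tangent_dual _ _ Cs uC) tl.
rewrite /incident trmx_mul Gs mulmxA -[_ *m T *m G]mulmxA.
have [e|npq] := boolP (p == q)%MS.
  have [_ /eqmxb_sym/andP[/sub_rVP[k ek] _]] := pq e.
  case/andP: e => _ /sub_rVP[k' ->]; rewrite linearZ /= -scalemxAr cayley4_mxE.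
  rewrite mulmxBr mulmxBl -scalemxAr -scalemxAl (hp : _ = 0) scaler0 sub0r.
  rewrite mulr2n mulmxDr mulmxDl !mulmxA ek -!scalemxAl -[_ *m G *m _]mulmxA.
  have -> : G *m p^T = k *: l^T by rewrite -linearZ -ek /= trmx_mul Gs.
  by rewrite -!scalemxAr tl !scaler0 addr0 oppr0 scaler0.
have [k ek] : exists k, cross p q = k *: l.
  apply/sub_rVP; apply: (incident_uniq _ _ p q) => //; try exact: incident_sym.
    exact: cross_incidentl.
  exact: cross_incidentr.
have Ds : (invmx C)^T = invmx C by rewrite trmx_inv Cs.
have := cross_dual_conic G (invmx C) p q Gs Ds; rewrite /= -cayley4_mxE ek.
rewrite (hp : _ = 0) (hq : _ = 0) mul0mx mulmx0 linearZ /= -!scalemxAl -scalemxAr tl.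
rewrite !scaler0 mul0rn !add0r => /eqP; rewrite eq_sym oppr_eq0 => /eqP.
have := chord_not_conj G p q Gs uG p0 q0 hp hq npq.
rewrite [p *m G *m q^T]mx11_scalar mul_scalar_mx -scaler_nat => n0 /eqP.
rewrite !scaler_eq0 (negPf K2) /= => /orP[/eqP z|/eqP -> //].
by rewrite z raddf0 eqxx in n0.
Qed.

(** If the endpoints differ, [p *m T] lies on [l] and on the polar of [q], which meet only at [q].
    If they coincide, [G] and [C] have the same tangent at [p], which makes [p] an eigenvector of
    [T]. *)
Lemma tangent_vertex_image l p q : p != 0 -> q != 0 -> l != 0 ->
  chord G l p q -> tangent_at C p l -> (p *m T <= q)%MS.
Proof.
move=> p0 q0 l0 ch tp; have tl : tangent C l by exists p.
have cj := tangent_chord_conj l p q p0 q0 l0 ch tl.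
case: ch => pl ql hp hq pq; case: tp => cp lpC.
have [e|npq] := boolP (p == q)%MS.
  have [_ lpG] := pq e; have /andP[/sub_rVP[k ek] _] : (p *m G == p *m C)%MS.
    by apply: eqmxb_trans lpC; exact: eqmxb_sym.
  case/andP: (e) => pq' _; apply: submx_trans pq'; apply/sub_rVP.
  exists (\tr (G *m invmx C) - k *+ 2).
  rewrite /T /cayley4_mx mulmxBr mul_mx_scalar mulr2n mulmxDr mulmxA ek -scalemxAl.
  by rewrite mulmxK // scalerBl mulr2n scalerDl.
apply: (incident_uniq _ _ l (q *m G)) => //.
- exact: mulmx_unit_neq0.
- apply: contraL (chord_not_conj G p q Gs uG p0 q0 hp hq npq) => /andP[_ e].
  apply/negPn/eqP.
  have : incident (q *m G) p by apply: sub_incident e _; exact: incident_sym.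
  by rewrite /incident => h; rewrite bilinear_sym // h trmx0.
- by rewrite /incident trmx_mul Gs mulmxA.
- case/andP: lpC => lpC _; apply: incident_sym; apply: sub_incident lpC _.
  apply: incident_sym; rewrite /incident /T /cayley4_mx mulmxBr mul_mx_scalar.
  rewrite trmx_mul Cs mulr2n mulmxDr mulmxBl mulmxDl -scalemxAl !mulmxA.
  by rewrite (cp : _ = 0) !(mulmxKV uC) (hp : _ = 0) scaler0 addr0 subrr.
Qed.

(** When [p0] and [p2] coincide, so do the two sides at [p1], and likewise at [p3]. Both vertices
    are then contact points with [C], and [T] sends them to the same point. *)
Lemma opposite_vertices_eq (uT : T \in unitmx) (p0 p1 p2 p3 l0 l1 l2 l3 : 'rV[K]_3) :
  p0 != 0 -> p1 != 0 -> p2 != 0 -> p3 != 0 ->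
  l0 != 0 -> l1 != 0 -> l2 != 0 -> l3 != 0 ->
  chord G l0 p0 p1 -> chord G l1 p1 p2 -> chord G l2 p2 p3 -> chord G l3 p3 p0 ->
  tangent_pair C p1 l0 l1 -> tangent_pair C p3 l2 l3 ->
  (p0 == p2)%MS -> (p1 == p3)%MS.
Proof.
move=> n0 n1 n2 n3 m0 m1 m2 m3 c0 c1 c2 c3 [_ _ _ _ t1] [_ _ _ _ t3] e.
have r p : (p == p)%MS by rewrite submx_refl.
have h1 : tangent_at C p1 l0.
  by apply/t1/(chord_uniq G _ _ p0 p1 p2 p1) => //; exact: chord_sym.
have h3 : tangent_at C p3 l2.
  apply/t3/(chord_uniq G _ _ p2 p3 p0 p3) => //; last exact: eqmxb_sym.
  exact: chord_sym.
have s1 := tangent_vertex_image l0 p1 p0 n1 n0 m0 (chord_sym _ _ _ _ c0) h1.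
have s3 := tangent_vertex_image l2 p3 p2 n3 n2 m2 (chord_sym _ _ _ _ c2) h3.
apply: (eqmxb_unit _ _ T uT).
apply: eqmxb_trans (eqmx_rV _ _ (mulmx_unit_neq0 _ _ uT n1) s1) _.
apply: eqmxb_trans e _; apply: eqmxb_sym; apply: eqmx_rV s3; exact: mulmx_unit_neq0.
Qed.

Lemma poncelet4_det0 : poncelet_pair 4 G C -> \det T = 0.
Proof.
move=> [P [L [pol ntriv]]]; apply/eqP; apply/negPn/negP => dT; apply: ntriv.
have uT : T \in unitmx by rewrite unitmxE unitfE.
have s0 : ordS 0 = 1 :> 'I_4 by exact: val_inj.
have s1 : ordS 1 = 2%:R :> 'I_4 by exact: val_inj.
have s2 : ordS 2%:R = 3%:R :> 'I_4 by exact: val_inj.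
have s3 : ordS 3%:R = 0 :> 'I_4 by exact: val_inj.
have := pol 0; have := pol 1; have := pol 2%:R; have := pol 3%:R.
rewrite s0 s1 s2 s3 => -[n3 m3 c3 t0] [n2 m2 c2 t3] [n1 m1 c1 t2] [n0 m0 c0 t1].
have [T0 T1] : tangent C (L 0) /\ tangent C (L 1) by case: t1.
have [T2 T3] : tangent C (L 2%:R) /\ tangent C (L 3%:R) by case: t3.
have A1 := opposite_vertices_eq uT _ _ _ _ _ _ _ _
  n0 n1 n2 n3 m0 m1 m2 m3 c0 c1 c2 c3 t1 t3.
have A2 := opposite_vertices_eq uT _ _ _ _ _ _ _ _
  n1 n2 n3 n0 m1 m2 m3 m0 c1 c2 c3 c0 t2 t0.
(* If these vertices differed, [P 1 *m T] and [P 3%:R *m T] would both be the unique intersection of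
   their polars. Then [P 1] and [P 3%:R] would coincide, and [A2] would give a contradiction. *)
have e02 : (P 0 == P 2%:R)%MS.
  apply: contraT => ne; case/negP: (ne); apply/eqmxb_sym/A2.
  apply: (eqmxb_unit _ _ T uT); apply/eqmxb_sym/eqmx_rV; first exact: mulmx_unit_neq0.
  apply: (incident_uniq _ _ (P 0 *m G) (P 2%:R *m G)); try exact: mulmx_unit_neq0.
  - by apply: contra ne; exact: eqmxb_unit.
  - by apply: tangent_chord_conj T0 => //; exact: chord_sym.
  - exact: tangent_chord_conj T1.
  - exact: tangent_chord_conj T3.
  - by apply: tangent_chord_conj T2 => //; exact: chord_sym.
have e13 := A1 e02.
have r p : (p == p)%MS by rewrite submx_refl.
(* Consecutive sides now have the same endpoints, so all sides coincide. By [tangent_pair], [P 1]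
   and [P 2%:R] are contact points of this one line with [C], and a tangent has only one contact
   point. *)
have l01 : (L 0 == L 1)%MS.
  by apply: (chord_uniq G _ _ (P 0) (P 1) (P 2%:R) (P 1)) => //; exact: chord_sym.
have l12 : (L 1 == L 2%:R)%MS.
  by apply: (chord_uniq G _ _ (P 1) (P 2%:R) (P 3%:R) (P 2%:R)) => //; exact: chord_sym.
have l23 : (L 2%:R == L 3%:R)%MS.
  apply: (chord_uniq G _ _ (P 2%:R) (P 3%:R) (P 0) (P 3%:R)) => //.
    exact: chord_sym.
  exact: eqmxb_sym.
have C1 : tangent_at C (P 1) (L 0) by case: t1 => _ _ _ _; exact.
have C2 : tangent_at C (P 2%:R) (L 1) by case: t2 => _ _ _ _; exact.
have p12 : (P 1 == P 2%:R)%MS.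
  apply: (eqmxb_unit _ _ C uC); case: C1 => _ /eqmxb_sym h1; case: C2 => _ h2.
  by apply: eqmxb_trans h1 (eqmxb_trans _ _ _ l01 h2).
exists (P 1), (L 1); split=> //.
- by case: c1 => _ _ _ _; exact.
- exact: tangent_at_eq (r _) l01 C1.
case=> [[|[|[|[|//]]]] hi].
- rewrite (_ : Ordinal hi = 0); last exact: val_inj.
  by split=> //; apply: eqmxb_trans e02 _; exact: eqmxb_sym.
- by rewrite (_ : Ordinal hi = 1) //; exact: val_inj.
- rewrite (_ : Ordinal hi = 2%:R); last exact: val_inj.
  by split; exact: eqmxb_sym.
- rewrite (_ : Ordinal hi = 3%:R); last exact: val_inj.
  by split; apply: eqmxb_sym => //; exact: eqmxb_trans l12 l23.
Qed.
End Pair.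
End ProjectivePoncelet.

(** * Coordinates for the circle and the confocal family *)

Section Confocal.
Variable K : fieldType.

Lemma incident_row3 (x y z u v w : K) :
  incident (row3 x y z) (row3 u v w) <-> x * u + y * v + z * w = 0.
Proof.
split=> [/matrixP/(_ 0 0)|h]; first by rewrite !(mxE, sum3E).
by apply/matrixP=> i j; rewrite !ord1 !(mxE, sum3E).
Qed.

Lemma on_circle_row3 (x0 y0 x y z : K) :
  on_conic (circle_mx x0 y0) (row3 x y z) <->
  (x - x0 * z) ^+ 2 + (y - y0 * z) ^+ 2 = z ^+ 2.
Proof.
have E : (row3 x y z *m circle_mx x0 y0 *m (row3 x y z)^T) 0 0 =
         (x - x0 * z) ^+ 2 + (y - y0 * z) ^+ 2 - z ^+ 2.
  by rewrite !(mxE, sum3E) /=; ring.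
rewrite /on_conic; split=> [h|/eqP]; first by apply/eqP; rewrite -subr_eq0 -E h mxE.
by rewrite -subr_eq0 -E => /eqP h; apply/matrixP=> i j; rewrite !ord1 h mxE.
Qed.

Lemma row3_sub (x y z u v w : K) : (row3 x y z <= row3 u v w)%MS ->
  [/\ x * v = y * u, x * w = z * u & y * w = z * v].
Proof.
case/sub_rVP=> k /rowP e; move: (e 0) (e 1) (e 2%:R); rewrite !mxE /= => -> -> ->.
by split; ring.
Qed.

Lemma row3_eq0 (x y z : K) : row3 x y z = 0 -> [/\ x = 0, y = 0 & z = 0].
Proof. by move/rowP=> e; move: (e 0) (e 1) (e 2%:R); rewrite !mxE. Qed.

Lemma circle_mx_sym (x0 y0 : K) : (circle_mx x0 y0)^T = circle_mx x0 y0.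
Proof. by apply/matrixP=> -[[|[|[|//]]] ?] [[|[|[|//]]] ?]; rewrite !mxE. Qed.

Lemma circle_mx_unit (x0 y0 : K) : circle_mx x0 y0 \in unitmx.
Proof.
rewrite unitmxE (_ : \det _ = -1) ?unitrN1 //.
by rewrite det3E !mxE /=; ring.
Qed.

Lemma confocal_mx_sym (a b t : K) : (confocal_mx a b t)^T = confocal_mx a b t.
Proof. exact: tr_diag_mx. Qed.

Lemma confocal_mxV (a b t : K) : a - t != 0 -> b - t != 0 ->
  confocal_mx a b t *m diag_mx (row3 (a - t) (b - t) (-1)) = 1%:M.
Proof.
move=> ha hb; rewrite /confocal_mx mulmx_diag -diag_const_mx; congr diag_mx.
by rewrite [LHS]row3E [RHS]row3E !mxE /= !mulVf // mulrNN mulr1.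
Qed.

Lemma confocal_mx_unit (a b t : K) : a - t != 0 -> b - t != 0 ->
  confocal_mx a b t \in unitmx.
Proof. by move=> ha hb; case/mulmx1_unit: (confocal_mxV a b t ha hb). Qed.

Lemma confocal_mx_inv (a b t : K) : a - t != 0 -> b - t != 0 ->
  invmx (confocal_mx a b t) = diag_mx (row3 (a - t) (b - t) (-1)).
Proof.
move=> ha hb; have uC := confocal_mx_unit a b t ha hb.
by rewrite -[RHS](mulKmx uC) confocal_mxV // mulmx1.
Qed.

(** The coordinate equations make the point the pole of the line; incidence with its own polar then
    puts it on the conic. *)
Lemma tangent_at_confocal (a b t x y z u v w : K) : a - t != 0 -> b - t != 0 ->
  row3 u v w != 0 -> x = (a - t) * u -> y = (b - t) * v -> z = - w ->
  incident (row3 x y z) (row3 u v w) ->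
  tangent_at (confocal_mx a b t) (row3 x y z) (row3 u v w).
Proof.
move=> ha hb l0 ex ey ez inc.
have e : row3 u v w = row3 x y z *m confocal_mx a b t.
  by rewrite [RHS]row3E mul_mx_diag !mxE /= ex ey ez; congr row3; field.
split; last by rewrite e submx_refl.
by rewrite /on_conic -e; exact: incident_sym.
Qed.

Lemma tangent_confocal (a b t u v w : K) : a - t != 0 -> b - t != 0 ->
  row3 u v w != 0 -> (a - t) * u ^+ 2 + (b - t) * v ^+ 2 = w ^+ 2 ->
  tangent (confocal_mx a b t) (row3 u v w).
Proof.
move=> ha hb l0 e; exists (row3 ((a - t) * u) ((b - t) * v) (- w)).
  apply: contra l0 => /eqP/row3_eq0[] /eqP.
  rewrite mulf_eq0 (negPf ha) => /eqP-> /eqP; rewrite mulf_eq0 (negPf hb) => /eqP->.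
  move=> /eqP; rewrite oppr_eq0 => /eqP->.
  by apply/eqP/rowP=> -[[|[|[|//]]] ?]; rewrite !mxE.
by apply: tangent_at_confocal => //; apply/incident_row3; rewrite mulNr -expr2 -e; ring.
Qed.

(** [tau], the bracket and [A * B] are the elementary symmetric functions of the eigenvalues $e_i$
    of $GC^{-1}$, while those of the [cayley4_mx] matrix are $\tau-2e_i$. *)
Lemma det_cayley4_confocal (a b t x0 y0 : K) : a - t != 0 -> b - t != 0 ->
  let s := x0 ^+ 2 + y0 ^+ 2 in
  let A := a - t in let B := b - t in
  let tau := A + B + 1 - s in
  - \det (cayley4_mx K (circle_mx x0 y0) (confocal_mx a b t)) =
  tau ^+ 3 - 4%:R * (A * B + A + B - A * y0 ^+ 2 - B * x0 ^+ 2) * tau + 8%:R * A * B.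
Proof.
move=> ha hb /=; rewrite /cayley4_mx confocal_mx_inv // det3E /mxtrace.
rewrite sum3E mul_mx_diag.
by rewrite !mxE /=; ring.
Qed.

(** * Explicit quadrangles for the two positions of the foci *)

Lemma poncelet_pair4I (G C : 'M[K]_3) (p0 p1 p2 p3 l0 l1 l2 l3 : 'rV[K]_3) :
  [/\ p0 != 0, l0 != 0, chord G l0 p0 p1 & tangent_pair C p1 l0 l1] ->
  [/\ p1 != 0, l1 != 0, chord G l1 p1 p2 & tangent_pair C p2 l1 l2] ->
  [/\ p2 != 0, l2 != 0, chord G l2 p2 p3 & tangent_pair C p3 l2 l3] ->
  [/\ p3 != 0, l3 != 0, chord G l3 p3 p0 & tangent_pair C p0 l3 l0] ->
  ~ (p0 <= p1)%MS -> poncelet_pair 4 G C.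
Proof.
move=> h0 h1 h2 h3 ne.
exists (fun i : 'I_4 => nth 0 [:: p0; p1; p2; p3] i).
exists (fun i : 'I_4 => nth 0 [:: l0; l1; l2; l3] i).
split; first by case=> [[|[|[|[|//]]]] hi].
(* All vertices of a trivial polygon represent one point, whereas [p0] and [p1] differ. *)
case=> p [l [_ _ _ h]]; apply: ne.
have [/andP[e0 _] _] := h 0; have [/andP[_ e1] _] := h 1.
exact: submx_trans e0 e1.
Qed.

Lemma chord_neq (M : 'M[K]_3) l p q : incident p l -> incident q l ->
  on_conic M p -> on_conic M q -> ~ (p <= q)%MS -> chord M l p q.
Proof. by move=> *; split=> // /andP[]. Qed.

Lemma tangent_pair_neq (M : 'M[K]_3) p l m : incident p l -> incident p m ->
  tangent M l -> tangent M m -> ~ (l <= m)%MS -> tangent_pair M p l m.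
Proof. by move=> *; split=> // /andP[]. Qed.

Lemma poncelet_foci_on_circle (a b t x0 y0 f j : K) :
  2%:R != 0 :> K -> j ^+ 2 = -1 -> f ^+ 2 = a - b -> f != 0 ->
  a - t != 0 -> b - t != 0 -> x0 = 0 -> f ^+ 2 + y0 ^+ 2 = 1 ->
  poncelet_pair 4 (circle_mx x0 y0) (confocal_mx a b t).
Proof.
move=> K2 j2 f2 f0 ha hb -> fy.
have j0 : j != 0.
  by apply/eqP => e; move/eqP: j2; rewrite e expr0n eq_sym oppr_eq0 oner_eq0.
have n2 (x : K) : x != 0 -> x <> - x.
  move=> x0' /eqP; rewrite -subr_eq0 opprK -mulr2n -mulr_natl mulf_eq0 (negPf K2).
  by rewrite (negPf x0').
have nz1 (y z : K) : row3 1 y z != 0.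
  by apply/eqP => /row3_eq0[] /eqP; rewrite oner_eq0.
have nz3 (y z : K) : row3 y z 1 != 0.
  by apply/eqP => /row3_eq0[] _ _ /eqP; rewrite oner_eq0.
(* For $u^2=-1$ the dual equation becomes $(a-t)-(b-t)=v^2$, from which $t$ disappears: these are
   the isotropic lines through the foci. *)
have tg (u v : K) : u ^+ 2 = -1 -> v ^+ 2 = f ^+ 2 ->
    tangent (confocal_mx a b t) (row3 1 u v).
  by move=> eu ev; apply: tangent_confocal => //; rewrite eu ev f2; ring.
have cf (u : K) : u ^+ 2 = f ^+ 2 -> on_conic (circle_mx 0 y0) (row3 u 0 1).
  move=> eu; apply/on_circle_row3.
  by rewrite mul0r subr0 mulr1 sub0r sqrrN eu expr1n.
have cj (u : K) : u ^+ 2 = -1 -> on_conic (circle_mx 0 y0) (row3 1 u 0).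
  by move=> eu; apply/on_circle_row3; rewrite !mulr0 !subr0 eu expr1n subrr expr0n.
have jN2 : (- j) ^+ 2 = -1 by rewrite sqrrN.
have fN2 : (- f) ^+ 2 = f ^+ 2 by rewrite sqrrN.
have fN := n2 f f0; have jN := n2 j j0.
have j2' : j * j = -1 by rewrite -expr2.
(* The vertices alternate between the foci and the circular points [row3 1 j 0] and
   [row3 1 (- j) 0]. *)
apply: (poncelet_pair4I _ _ (row3 f 0 1) (row3 1 j 0) (row3 (- f) 0 1) (row3 1 (- j) 0)
  (row3 1 j (- f)) (row3 1 j f) (row3 1 (- j) f) (row3 1 (- j) (- f))).
all: try (split=> //; [apply: chord_neq | apply: tangent_pair_neq]).
all: try by [apply: cf | apply: cj | apply: tg].
all: try by apply/incident_row3; rewrite ?mulrN ?mulNr ?j2'; ring.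
all: move=> /row3_sub[]; rewrite ?(mulr1, mul1r, mulr0, mul0r).
all: try by move=> _ /eqP; rewrite ?oner_eq0 // eq_sym oner_eq0.
all: by [move=> _ /fN | move=> _ /esym/fN | move=> /jN | move=> /esym/jN].
Qed.

(** The point [row3 w 0 1] is where the circle meets the x-axis. Its tangents to the conic touch it
    at [row3 (a - t) h w] and [row3 (a - t) (- h) w], and the relation on [x0] puts these contact
    points on the circle. The condition on [h] keeps the two tangents distinct. *)
Lemma poncelet_foci_symmetric (a b t x0 w h : K) :
  2%:R != 0 :> K -> a - t != 0 -> b - t != 0 -> (w - x0) ^+ 2 = 1 ->
  x0 ^+ 2 = 1 + (a - b) -> h ^+ 2 = (b - t) * (w ^+ 2 - (a - t)) -> h != 0 ->
  poncelet_pair 4 (circle_mx x0 0) (confocal_mx a b t).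
Proof.
move=> K2 ha hb hw hx h2 h0.
have nz1 (y z : K) : row3 1 y z != 0.
  by apply/eqP => /row3_eq0[] /eqP; rewrite oner_eq0.
have nz3 (y z : K) : row3 y z 1 != 0.
  by apply/eqP => /row3_eq0[] _ _ /eqP; rewrite oner_eq0.
have nzA (y z : K) : row3 (a - t) y z != 0.
  by apply/eqP => /row3_eq0[] /eqP; rewrite (negPf ha).
have oP k : k ^+ 2 = h ^+ 2 -> on_conic (circle_mx x0 0) (row3 (a - t) k w).
  move=> ek; apply/on_circle_row3; rewrite mul0r subr0 ek h2.
  have -> : b - t = a - t + 1 - x0 ^+ 2 by rewrite hx; ring.
  apply/eqP; rewrite -subr_eq0; apply/eqP.
  transitivity ((a - t) * ((w - x0) ^+ 2 - 1)); first by ring.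
  by rewrite hw subrr mulr0.
have oQ : on_conic (circle_mx x0 0) (row3 w 0 1).
  by apply/on_circle_row3; rewrite mulr1 mul0r subr0 hw expr0n addr0 expr1n.
have hP k : k ^+ 2 = h ^+ 2 -> incident (row3 (a - t) k w) (row3 1 (k / (b - t)) (- w)).
  move=> ek; apply/incident_row3.
  have -> : k * (k / (b - t)) = k ^+ 2 / (b - t) by rewrite expr2 mulrA.
  by rewrite ek h2; field.
have hQ k : incident (row3 w 0 1) (row3 1 (k / (b - t)) (- w)).
  by apply/incident_row3; ring.
have tP k : k ^+ 2 = h ^+ 2 ->
    tangent_at (confocal_mx a b t) (row3 (a - t) k w) (row3 1 (k / (b - t)) (- w)).
  move=> ek; apply: tangent_at_confocal; rewrite ?opprK ?mulr1 //; last exact: hP.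
  by field.
have t0 k : k ^+ 2 = h ^+ 2 -> tangent (confocal_mx a b t) (row3 1 (k / (b - t)) (- w)).
  by move=> ek; exists (row3 (a - t) k w) => //; exact: tP.
have hN : (- h) ^+ 2 = h ^+ 2 by rewrite sqrrN.
have nPQ k : k != 0 -> ~ (row3 (a - t) k w <= row3 w 0 1)%MS.
  by move=> k0 /row3_sub[_ _]; rewrite mulr0 mulr1 => /eqP; rewrite (negPf k0).
have nQP k : k != 0 -> ~ (row3 w 0 1 <= row3 (a - t) k w)%MS.
  by move=> k0 /row3_sub[_ _]; rewrite mul0r mul1r => /eqP; rewrite eq_sym (negPf k0).
have hN0 : - h != 0 by rewrite oppr_eq0.
have nL k : k != 0 -> ~ (row3 1 (k / (b - t)) (- w) <= row3 1 (- k / (b - t)) (- w))%MS.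
  move=> k0 /row3_sub[+ _ _]; rewrite mul1r mulr1 => /(mulIf (invr_neq0 hb))/eqP.
  by rewrite -subr_eq0 -opprD oppr_eq0 -mulr2n -mulr_natl mulf_eq0 (negPf K2)
    (negPf k0).
(* The path turns back at each contact point, where the two sides coincide, and changes tangent at
   [row3 w 0 1]. *)
apply: (poncelet_pair4I _ _ (row3 (a - t) h w) (row3 w 0 1)
  (row3 (a - t) (- h) w) (row3 w 0 1)
  (row3 1 (h / (b - t)) (- w)) (row3 1 (- h / (b - t)) (- w))
  (row3 1 (- h / (b - t)) (- w)) (row3 1 (h / (b - t)) (- w))); last exact: nPQ.
- split=> //; first by apply: chord_neq; auto.
  by apply: tangent_pair_neq; auto.
- split=> //; first by apply: chord_neq; auto.
  by split; auto.
- split=> //; first by apply: chord_neq; auto.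
  by apply: tangent_pair_neq; auto; have := nL _ hN0; rewrite opprK.
- split=> //; first by apply: chord_neq; auto.
  by split; auto.
Qed.
End Confocal.

(** * Real positions of the foci and the resulting equivalence *)

Lemma foci_positionP (R : realType) (f x0 y0 : R) : 0 < f ->
  (on_circle (x0, y0) 1 (f, 0) /\ on_circle (x0, y0) 1 (- f, 0))
   \/ circle_symmetric (x0, y0) 1 (f, 0) (- f, 0)
  <-> (x0 = 0 /\ f ^+ 2 + y0 ^+ 2 = 1) \/ (y0 = 0 /\ x0 ^+ 2 = 1 + f ^+ 2).
Proof.
move=> f0; have fn : f != 0 by rewrite gt_eqF.
have f2n : f *+ 2 != 0 by rewrite mulrn_eq0.
rewrite /on_circle /circle_symmetric /inversion /= expr1n.
split=> -[].
- case=> e1 e2; left.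
  have /eqP : (f *+ 2 * 2%:R) * x0 = 0.
    transitivity ((- f - x0) ^+ 2 + (0 - y0) ^+ 2 - ((f - x0) ^+ 2 + (0 - y0) ^+ 2)).
      by ring.
    by rewrite e1 e2 subrr.
  rewrite !mulf_eq0 (negPf f2n) pnatr_eq0 /= => /eqP x00.
  by split=> //; rewrite -e1 x00; ring.
- case=> n1 n2 [e1 e2] _; right.
  set k := 1 / _ in e1 e2.
  have y00 : y0 = 0.
    apply/eqP; apply: contraT => yn.
    (* Off the x-axis, the second coordinate of the inverse forces ratio 1; the inversion would then
       fix the first focus, which differs from the second. *)
    have k1 : k = 1.
      apply: (mulIf yn); rewrite mul1r; apply/eqP; rewrite -subr_eq0 -oppr_eq0.
      by apply/eqP; rewrite -[RHS]e2; ring.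
    move: e1; rewrite k1 mul1r subrKC => /eqP; rewrite -subr_eq0 opprK -mulr2n.
    by rewrite (negPf f2n).
  split=> //.
  have d0 : f - x0 != 0.
    by apply/eqP => /eqP; rewrite subr_eq0 => /eqP e; apply: n1; rewrite y00 e.
  have : (x0 + k * (f - x0)) * (f - x0) = - f * (f - x0) by rewrite e1.
  have -> : (x0 + k * (f - x0)) * (f - x0) = x0 * (f - x0) + 1.
    by rewrite /k y00; field.
  move=> /eqP; rewrite -subr_eq0 => /eqP e; apply/eqP; rewrite -subr_eq0 -oppr_eq0.
  by apply/eqP; rewrite -[RHS]e; ring.
- by case=> -> e; left; split; rewrite -e; ring.
- case=> -> e; right.
  have P : (f - x0) * (- f - x0) = 1.
    by transitivity (x0 ^+ 2 - f ^+ 2); [ring | rewrite e; ring].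
  have d1 : f - x0 != 0.
    by apply/eqP => z; move/eqP: P; rewrite z mul0r eq_sym oner_eq0.
  have d2 : - f - x0 != 0.
    by apply/eqP => z; move/eqP: P; rewrite z mulr0 eq_sym oner_eq0.
  split.
  + by case=> z; move: d1; rewrite z subrr eqxx.
  + by case=> z; move: d2; rewrite z subrr eqxx.
  + congr pair; last by ring.
    transitivity (x0 + ((f - x0) * (- f - x0)) / (f - x0)); last by field.
    by rewrite P; field.
  + congr pair; last by ring.
    transitivity (x0 + ((f - x0) * (- f - x0)) / (- f - x0)); last by field.
    by rewrite P; field.
Qed.

Theorem theorem3p6 (R : realType) (a b x0 y0 : R) (hb : 0 < b) (hab : b < a) :
  (forall t : R[i], t <> a%:C -> t <> b%:C ->
     poncelet_pair 4 (circle_mx x0%:C y0%:C) (confocal_mx a%:C b%:C t))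
  <->
  (let F1 := (Num.sqrt (a - b), 0) in
   let F2 := (- Num.sqrt (a - b), 0) in
   (on_circle (x0, y0) 1 F1 /\ on_circle (x0, y0) 1 F2)
   \/ circle_symmetric (x0, y0) 1 F1 F2).
Proof.
have c0 : 0 < a - b by rewrite subr_gt0.
have f0 : 0 < Num.sqrt (a - b) by rewrite sqrtr_gt0.
have f2 : Num.sqrt (a - b) ^+ 2 = a - b by rewrite sqr_sqrtr // ltW.
have C2 : 2%:R != 0 :> R[i] by rewrite pnatr_eq0.
rewrite /= foci_positionP //; move: (Num.sqrt (a - b)) f0 f2 => f f0 f2.
rewrite f2; split.
  move=> H.
  (* Real parameters below [b] avoid both excluded values, and the complex determinant identity
     descends to the reals by injectivity of the embedding. *)
  have E (t : R) : t < b -> let s := x0 ^+ 2 + y0 ^+ 2 in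
      let A := a - t in let B := b - t in
      let tau := A + B + 1 - s in
      tau ^+ 3 - 4%:R * (A * B + A + B - A * y0 ^+ 2 - B * x0 ^+ 2) * tau
        + 8%:R * A * B = 0.
    move=> tb /=; have ta : t < a by exact: lt_trans hab.
    have nb : b%:C - t%:C != 0 by rewrite -rmorphB /= fmorph_eq0 subr_eq0 gt_eqF.
    have na : a%:C - t%:C != 0 by rewrite -rmorphB /= fmorph_eq0 subr_eq0 gt_eqF.
    have Ht : poncelet_pair 4 (circle_mx x0%:C y0%:C) (confocal_mx a%:C b%:C t%:C).
      by apply: H => e; [move: na | move: nb]; rewrite e subrr eqxx.
    have := det_cayley4_confocal _ a%:C b%:C t%:C x0%:C y0%:C na nb.
    rewrite poncelet4_det0 ?oppr0 ?circle_mx_sym ?confocal_mx_sym ?circle_mx_unit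
      ?confocal_mx_unit //= => /esym e.
    apply: (@complexI R); rewrite rmorph0 -[RHS]e.
    by rewrite !(rmorphD, rmorphN, rmorphM, rmorphXn, rmorph_nat, rmorph1).
  (* The left-hand side of [E] is affine in [t]: two values of [t] suffice. *)
  pose k := a - b + 1 - (x0 ^+ 2 + y0 ^+ 2).
  have e0 := E 0 hb; have e1 : _ := E (-1) (lt_trans (ltrN10 _) hb).
  (* Since $\tau=k+2(b-t)$, the left-hand side of [E] equals
     $2(b-t)(k^2-2k+4(a-b)y_0^2)+k(k^2-4(a-b)(1-y_0^2))$. The difference of [e1] and [e0] isolates
     the first bracket, and [e0] then gives the remaining term. *)
  have q1 : k ^+ 2 - 2%:R * k + 4%:R * (a - b) * y0 ^+ 2 = 0.
    apply: (@mulfI _ 2%:R); first by rewrite pnatr_eq0.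
    by rewrite mulr0 -[RHS](subrr 0) -{1}e1 -e0 /k; ring.
  have q0 : k * (k ^+ 2 - 4%:R * (a - b) * (1 - y0 ^+ 2)) = 0.
    transitivity (k * (k ^+ 2 - 4%:R * (a - b) * (1 - y0 ^+ 2))
      + 2%:R * b * (k ^+ 2 - 2%:R * k + 4%:R * (a - b) * y0 ^+ 2)).
      by rewrite q1 mulr0 addr0.
    by rewrite -[RHS]e0 /k; ring.
  (* For [k = 0], [q1] leaves $4(a-b)y_0^2=0$, the symmetric position; otherwise [k] cancels in
     [q0]. *)
  have [kz|kn] := eqVneq k 0; [right | left].
    move: q1; rewrite kz expr0n mulr0 subrr add0r => /eqP.
    rewrite !mulf_eq0 pnatr_eq0 (gt_eqF c0) /= orbb => /eqP yz; split=> //.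
    by apply/eqP; rewrite -subr_eq0 -oppr_eq0; apply/eqP; rewrite -[RHS]kz /k yz; ring.
  move/eqP: q0; rewrite mulf_eq0 (negPf kn) => /eqP q0.
  have k2 : k = 2%:R * (a - b).
    apply: (@mulfI _ 2%:R); first by rewrite pnatr_eq0.
    apply/eqP; rewrite -subr_eq0; apply/eqP; rewrite -[RHS](subrr 0) -{1}q0 -q1; ring.
  have yc : a - b + y0 ^+ 2 = 1.
    apply: (@mulfI _ (4%:R * (a - b))); first by rewrite mulf_neq0 ?pnatr_eq0 ?gt_eqF.
    by apply/eqP; rewrite -subr_eq0; apply/eqP; rewrite -[RHS]q0 k2; ring.
  split=> //; apply/eqP; rewrite -sqrf_eq0; apply/eqP.
  transitivity (2%:R * (a - b) - k + 1 - (a - b + y0 ^+ 2)); first by rewrite /k; ring.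
  by rewrite k2 yc; ring.
move=> H t ta tb.
have na : a%:C - t != 0 by rewrite subr_eq0; apply/eqP => e; exact: ta.
have nb : b%:C - t != 0 by rewrite subr_eq0; apply/eqP => e; exact: tb.
case: H => -[z e].
  apply: (poncelet_foci_on_circle _ _ _ _ _ _ f%:C 'i) => //.
  - by rewrite sqr_i.
  - by rewrite -rmorphXn f2 rmorphB.
  - by rewrite fmorph_eq0 gt_eqF.
  - by rewrite z.
  - by rewrite -!rmorphXn -rmorphD /= f2 e.
rewrite z.
have xn : x0%:C != 0 :> R[i].
  by rewrite fmorph_eq0 -sqrf_eq0 e gt_eqF // addr_gt0.
(* Here [w] is an end of the diameter on the x-axis, and the inequality makes the chosen square root
   [h] nonzero. *)
have key (w : R[i]) : (w - x0%:C) ^+ 2 = 1 -> w ^+ 2 != a%:C - t ->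
    poncelet_pair 4 (circle_mx x0%:C 0) (confocal_mx a%:C b%:C t).
  move=> hw hn; apply: (poncelet_foci_symmetric _ _ _ _ _ w
    (sqrtC ((b%:C - t) * (w ^+ 2 - (a%:C - t))))) => //.
  - by rewrite -rmorphXn e !(rmorphD, rmorphN, rmorph1).
  - by rewrite sqrtCK.
  - by rewrite sqrtC_eq0 mulf_neq0 // subr_eq0.
(* The squares of $x_0+1$ and $x_0-1$ differ by $4x_0\neq0$, so at least one end of the diameter
   satisfies the inequality. *)
have [h1|] := eqVneq ((x0%:C + 1) ^+ 2) (a%:C - t); last first.
  by apply: key; ring.
apply: (key (x0%:C - 1)); first by ring.
rewrite -h1 -subr_eq0 (_ : _ - _ = - (2%:R * 2%:R) * x0%:C); last by ring.
by rewrite mulf_neq0 // oppr_eq0 mulf_neq0.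
Qed.
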